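(* Let $\{\varphi_k : k\ge 1\}$ be an orthonormal system of functions of $L^2(0,1)$ that contains $\varphi_1(x)=1$, and let $(\lambda_k)_{k>1}$ be real numbers such that $$\sum_{k>1}\lambda_k^2<\infty$$ and $$1+\sum_{k>1}\lambda_k\alpha_k\ge 0,\qquad \alpha_k=\begin{cases}\max\varphi_k^2 & \text{if }\lambda_k<0,\\ \min\varphi_k\,\max\varphi_k & \text{if }\lambda_k>0.\end{cases}$$ Then the function $$C(u,v)=uv+\sum_{k>1}\lambda_k\int_0^u\varphi_k(x)\,dx\int_0^v\varphi_k(y)\,dy,\qquad (u,v)\in[0,1]^2,$$ is an absolutely continuous symmetric copula with square integrable density.
   Context: A (bivariate) copula is the restriction to $[0,1]^2$ of a bivariate joint cumulative distribution function with uniform marginals on $(0,1)$. It is absolutely continuous with density $c\ge 0$ if $C(u,v)=\int_0^u\int_0^v c(s,t)\,dt\,ds$; symmetric if $C(u,v)=C(v,u)$; its density is square integrable if $\int_0^1\int_0^1 c^2<\infty$. Maxima and minima are taken over $[0,1]$ and are assumed to exist for those $k$ with $\lambda_k\neq0$; terms with $\lambda_k=0$ contribute $0$ to the sums. *)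

(* Defs.v *)
From HB Require Import structures.
From mathcomp Require Import all_boot all_order all_algebra.
From mathcomp Require Import all_classical all_reals all_analysis.
Import Order.TTheory GRing.Theory Num.Theory.
Import numFieldNormedType.Exports.

Set Implicit Arguments.
Unset Strict Implicit.
Unset Printing Implicit Defensive.

Local Open Scope classical_set_scope.
Local Open Scope ring_scope.

Definition attains_max (R : realType) (f : R -> R) : Prop :=
  exists2 x, x \in `[0, 1] & forall y, y \in `[0, 1] -> f y <= f x.

Definition attains_min (R : realType) (f : R -> R) : Prop :=
  exists2 x, x \in `[0, 1] & forall y, y \in `[0, 1] -> f x <= f y.

(* These are the maximum and the minimum over [0, 1] whenever [attains_max f],
   respectively [attains_min f], holds. *)
Definition max01 (R : realType) (f : R -> R) : R := sup (f @` `[0, 1]).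
Definition min01 (R : realType) (f : R -> R) : R := inf (f @` `[0, 1]).

Definition in_L2 (R : realType) (f : R -> R) : Prop :=
  measurable_fun (`]0%R, 1%R[ : set R) f /\
  (\int[@lebesgue_measure R]_(x in `]0%R, 1%R[) ((f x) ^+ 2)%:E < +oo)%E.

(* The systems are indexed by k >= 1; the value at index 0 is irrelevant. *)
Definition orthonormal_system (R : realType) (phi : nat -> R -> R) : Prop :=
  (forall k, (1 <= k)%N -> in_L2 (phi k)) /\
  (forall j k, (1 <= j)%N -> (1 <= k)%N ->
    (\int[@lebesgue_measure R]_(x in `]0%R, 1%R[) (phi j x * phi k x))%R
      = (j == k)%:R).

(* At l = 0 the value is irrelevant: [alpha l f] only occurs multiplied by l. *)
Definition alpha (R : realType) (l : R) (f : R -> R) : R :=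
  if l < 0 then max01 (fun x => f x ^+ 2) else min01 f * max01 f.

Definition extrema_exist (R : realType) (l : R) (f : R -> R) : Prop :=
  (l < 0 -> attains_max (fun x => f x ^+ 2)) /\
  (0 < l -> attains_min f /\ attains_max f).

Definition prim (R : realType) (f : R -> R) (u : R) : R :=
  (\int[@lebesgue_measure R]_(x in `[0%R, u]) f x)%R.

Definition Cterm (R : realType) (phi : nat -> R -> R) (lambda : nat -> R)
    (u v : R) (k : nat) : R :=
  lambda k * prim (phi k) u * prim (phi k) v.

Definition Cfun (R : realType) (phi : nat -> R -> R) (lambda : nat -> R)
    (u v : R) : R :=
  u * v + \big[+%R/0]_(2 <= k <oo) Cterm phi lambda u v k.

(* P is the law on R x R whose joint distribution function restricts to C;
   C is only considered on [0, 1] x [0, 1]. *)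
Definition is_copula (R : realType) (C : R -> R -> R) : Prop :=
  exists P : probability (measurableTypeR R * measurableTypeR R)%type R,
  [/\ forall A : set (measurableTypeR R), measurable A ->
        pushforward P fst A = uniform_prob (@ltr01 R) A,
      forall A : set (measurableTypeR R), measurable A ->
        pushforward P snd A = uniform_prob (@ltr01 R) A
    & forall u v : R, u \in `[0, 1] -> v \in `[0, 1] ->
        P (`]-oo, u] `*` `]-oo, v]) = (C u v)%:E].

Definition symmetric01 (R : realType) (C : R -> R -> R) : Prop :=
  forall u v : R, u \in `[0, 1] -> v \in `[0, 1] -> C u v = C v u.

(* The iterated integrals are taken in the extended reals, so that null sets on
   which the inner integral is infinite are harmless. *)
Definition has_density (R : realType) (C : R -> R -> R)
    (c : measurableTypeR R * measurableTypeR R -> R) : Prop :=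
  [/\ measurable_fun (`[0%R, 1%R] `*` `[0%R, 1%R]
        : set (measurableTypeR R * measurableTypeR R)) c,
      forall s t : R, s \in `[0, 1] -> t \in `[0, 1] -> 0 <= c (s, t)
    & forall u v : R, u \in `[0, 1] -> v \in `[0, 1] ->
        (C u v)%:E = (\int[@lebesgue_measure R]_(s in `[0%R, u])
                      \int[@lebesgue_measure R]_(t in `[0%R, v])
                        (c (s, t))%:E)%E].

Definition square_integrable_density (R : realType)
    (c : measurableTypeR R * measurableTypeR R -> R) : Prop :=
  (\int[@lebesgue_measure R]_(s in `[0%R, 1%R])
   \int[@lebesgue_measure R]_(t in `[0%R, 1%R])
     ((c (s, t)) ^+ 2)%:E < +oo)%E.

(* Main.v *)
(* Write psi_k for phi_k set to 0 outside [0, 1], and b_k = lambda_k alpha_k. As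
   phi_k is orthogonal to 1, min phi_k <= 0 <= max phi_k, so b_k <= 0 and b_k is
   a lower bound of lambda_k psi_k(s) psi_k(t) for all s, t. The density
     1 + sum_k lambda_k psi_k(s) psi_k(t)
       = (1 + sum_k b_k) + sum_k (lambda_k psi_k(s) psi_k(t) - b_k)
   is thus a nonnegative constant plus a series of nonnegative terms: it makes
   sense in [0, +oo] at every point and may be integrated termwise by monotone
   convergence. Its integral in t over [0, 1] is 1 for every s, hence it is
   finite for almost every t, the marginals are uniform, and integrating over
   [0, u] x [0, v] gives C(u, v) together with the convergence of the series.
   For square integrability, Fatou's lemma in t applied to the partial sums
   bounds the integral of the square by 1 + sum_k lambda_k^2 psi_k(s)^2, which
   is then integrated termwise in s. *)
Require Import Defs.
From HB Require Import structures.
From mathcomp Require Import all_boot all_order all_algebra.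
From mathcomp Require Import all_classical all_reals all_analysis.
From mathcomp Require Import measurable_realfun.
From mathcomp Require Import ring lra.
Import Order.TTheory GRing.Theory Num.Theory.
Import numFieldNormedType.Exports.
Set Implicit Arguments.
Unset Strict Implicit.
Unset Printing Implicit Defensive.
Local Open Scope classical_set_scope.
Local Open Scope ring_scope.

(** * Measures given by a density, and real limits of nonnegative series *)

(* The hypotheses are arguments so that the canonical measure structure below
   can be inferred from the term. *)
Definition density_measure d (T : measurableType d) (R : realType)
    (mu : {measure set T -> \bar R}) (f : T -> \bar R)
    (mf : measurable_fun setT f) (f_ge0 : forall x, (0 <= f x)%E) :=
  fun X : set T => (\int[mu]_(x in X) f x)%E.

Section density_measure_instances.
Context d (T : measurableType d) (R : realType).
Variables (mu : {measure set T -> \bar R}) (f : T -> \bar R).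
Hypotheses (mf : measurable_fun setT f) (f_ge0 : forall x, (0 <= f x)%E).
Local Notation law := (density_measure mu mf f_ge0).

Let law0 : law set0 = 0%E.
Proof. by rewrite /density_measure integral_set0. Qed.

Let law_ge0 X : (0 <= law X)%E.
Proof. exact: integral_ge0. Qed.

Let law_sigma_additive : semi_sigma_additive law.
Proof.
move=> /= F mF tF mUF; rewrite /density_measure; apply: cvg_toP.
  apply: ereal_nondecreasing_is_cvgn => m n mn.
  by apply: lee_sum_nneg_natr => // k _ _; exact: law_ge0.
by rewrite ge0_integral_bigcup//; exact: measurable_funTS.
Qed.

HB.instance Definition _ :=
  isMeasure.Build _ _ _ law law0 law_ge0 law_sigma_additive.

Lemma density_probability : (\int[mu]_x f x = 1)%E ->
  exists P : probability T R, forall X, P X = (\int[mu]_(x in X) f x)%E.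
Proof.
move=> f1; have lawT : law setT = 1%E by [].
pose P : probability T R := HB.pack law (Measure_isProbability.Build _ _ _ law lawT).
by exists P.
Qed.

End density_measure_instances.

(** Nonnegativity makes the partial sums converge in the extended reals; as the limit is finite,
    [fine] carries the convergence over to the reals. *)
Lemma nneseries_cvg (R : realType) (x : nat -> R) (q : R) :
  (forall k, 0 <= x k) -> (\sum_(k <oo) (x k)%:E = q%:E)%E ->
  (\sum_(0 <= k < n) x k)%R @[n --> \oo] --> q.
Proof.
move=> x0 xq.
have h : (EFin \o (fun n => \sum_(0 <= k < n) x k)%R) @ \oo --> q%:E.
  rewrite (_ : _ \o _ = (fun n => \sum_(0 <= k < n) (x k)%:E)%E); last first.
    by apply/funext => n /=; rewrite sumEFin.
  by rewrite -xq; apply: is_cvg_nneseries => n _ _; rewrite lee_fin.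
exact: fine_cvg h.
Qed.

(** * Limits under the integral sign *)

Section affine_integrals.
Context (R : realType).
Local Notation mu := (@lebesgue_measure R).
Local Notation I01 := (`[0%R, 1%R]%classic : set R).

Lemma mu_sub01 (A : set R) : measurable A -> A `<=` I01 -> (mu A < +oo)%E.
Proof.
move=> mA AI; apply: (@le_lt_trans _ _ (mu I01)).
  by apply: le_measure; rewrite ?inE.
by rewrite lebesgue_measure_itv /= lte_fin ltr01 ltry.
Qed.

Lemma mu01 : mu I01 = 1%E.
Proof. by rewrite lebesgue_measure_itv /= lte_fin ltr01 oppr0 adde0. Qed.

Lemma bounded_integrable (A : set R) (f : R -> R) (M : R) :
  measurable A -> A `<=` I01 -> measurable_fun setT f ->
  (forall x, `|f x| <= M) -> mu.-integrable A (EFin \o f).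
Proof.
move=> mA AI mf fM; apply: measurable_bounded_integrable => //.
- exact: mu_sub01.
- exact: measurable_funTS.
- by exists M; split=> [|N /ltW MN x _]; rewrite ?num_real//; exact: le_trans MN.
Qed.

Variable psi : nat -> R -> R.
Hypothesis mpsi : forall k, measurable_fun setT (psi k).
Hypothesis bpsi : forall k, exists M, forall x, `|psi k x| <= M.

Lemma psi_integrable k A : measurable A -> A `<=` I01 ->
  mu.-integrable A (EFin \o psi k).
Proof. by move=> mA AI; have [M hM] := bpsi k; exact: bounded_integrable hM. Qed.

Lemma integral_affine k (A : set R) (a c : R) : measurable A -> A `<=` I01 ->
  (\int[mu]_(x in A) (a * psi k x + c)%:E
   = (a * (\int[mu]_(x in A) psi k x)%R + c * fine (mu A))%:E)%E.
Proof.
move=> mA AI.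
have ip := psi_integrable k mA AI.
have muA : mu A \is a fin_num by rewrite ge0_fin_numE// mu_sub01.
under eq_integral do rewrite EFinD.
rewrite integralD//=; last 2 first.
- under eq_fun do rewrite EFinM.
  exact: integrableZl.
- by apply: (@bounded_integrable A (cst c) `|c|) => //=.
have iA : (\int[mu]_(x in A) (psi k x)%:E)%E \is a fin_num by exact: integrable_fin_num.
rewrite integral_cst//= [in RHS]EFinD !EFinM !fineK//; congr (_ + _)%E.
by rewrite -integralZl//; apply: eq_integral => x _; rewrite EFinM.
Qed.

Lemma affine_measurable k (a c : R) (A : set R) :
  measurable_fun A (EFin \o (fun x => a * psi k x + c)).
Proof.
apply: measurable_funTS; apply/measurable_EFinP.
by apply: measurable_funD => //; apply: measurable_funM.
Qed.

(** Only the full terms [a k * psi k x + c k] have a sign. Monotone convergence is applied to them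
    first; each is then split by linearity, [psi k] being bounded on a set of finite measure. *)
Lemma integral_affine_series (K : R) (a c : nat -> R) (A : set R) :
  measurable A -> A `<=` I01 -> 0 <= K ->
  (forall k x, A x -> 0 <= a k * psi k x + c k) ->
  (\int[mu]_(x in A) (K%:E + \sum_(k <oo) (a k * psi k x + c k)%:E)
  = K%:E * mu A
    + \sum_(k <oo) (a k * (\int[mu]_(x in A) psi k x)%R + c k * fine (mu A))%:E)%E.
Proof.
move=> mA AI K0 ge0.
rewrite ge0_integralD//=; last 2 first.
- by move=> x Ax; apply: nneseries_ge0 => k _ _; rewrite lee_fin ge0.
- apply: ge0_emeasurable_sum => // [k x Ax _|k _]; first by rewrite lee_fin ge0.
  exact: affine_measurable.
rewrite integral_cst// integral_nneseries//; last first.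
  by move=> k; exact: affine_measurable.
by congr (_ + _)%E; apply: eq_eseriesr => k _; rewrite integral_affine.
Qed.

End affine_integrals.

(** Almost everywhere [f] is the lower limit of the [f_ n], so Fatou's lemma bounds its integral by
    the lower limit of integrals that are at most [K]. *)
Lemma le_integral_ae_cvg d (T : measurableType d) (R : realType)
    (mu : {measure set T -> \bar R}) (D : set T) (f_ : nat -> T -> \bar R)
    (f : T -> \bar R) (K : \bar R) :
  measurable D -> (forall n, measurable_fun D (f_ n)) -> measurable_fun D f ->
  (forall n x, D x -> (0 <= f_ n x)%E) -> (forall x, D x -> (0 <= f x)%E) ->
  {ae mu, forall x, D x -> f_ ^~ x @ \oo --> f x} ->
  (forall n, (\int[mu]_(x in D) f_ n x <= K)%E) ->
  (\int[mu]_(x in D) f x <= K)%E.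
Proof.
move=> mD mf_ mf f_0 f0 f_f leK.
have liminf_ge0 x : D x -> (0 <= limn_einf (f_ ^~ x))%E.
  move=> Dx; rewrite limn_einf_lim; apply: lime_ge; first exact: is_cvg_einfs.
  by apply: nearW => n; apply: le_ereal_inf_tmp => _ [m /= nm <-]; exact: f_0.
apply: (@le_trans _ _ (\int[mu]_(x in D) limn_einf (f_ ^~ x))%E).
  apply: ae_ge0_le_integral => //.
  - apply: measurableT_comp => //; apply: measurable_fun_limn_esup => n.
    exact: measurableT_comp.
  - move: f_f; apply: filterS.
    by move=> x fx Dx; have [-> _] := cvg_limn_einf_sup (fx Dx).
apply: le_trans (fatou mu mD mf_ f_0) _.
rewrite limn_einf_lim; apply: lime_le; first exact: is_cvg_einfs.
(* The infimum over the tail from [n] on is at most the integral of index [n] itself. *)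
by apply: nearW => n; apply: ereal_inf_le; exists (\int[mu]_(x in D) f_ n x)%E;
  [exists n => /=|].
Qed.

(** * A Bessel-type bound for partial sums *)

Section bessel.
Context (R : realType).
Local Notation mu := (@lebesgue_measure R).
Local Notation I01 := (`[0%R, 1%R]%classic : set R).

Definition bounded_measurable (f : R -> R) :=
  measurable_fun setT f /\ exists M, forall x, `|f x| <= M.

Lemma bounded_measurableD f g : bounded_measurable f -> bounded_measurable g ->
  bounded_measurable (fun x => f x + g x).
Proof.
move=> [mf [M fM]] [mg [N gN]]; split; first exact: measurable_funD.
by exists (M + N) => x; rewrite (le_trans (ler_normD _ _))// lerD.
Qed.

Lemma bounded_measurableM f g : bounded_measurable f -> bounded_measurable g ->
  bounded_measurable (fun x => f x * g x).
Proof.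
move=> [mf [M fM]] [mg [N gN]]; split; first exact: measurable_funM.
by exists (M * N) => x; rewrite normrM ler_pM.
Qed.

Lemma bounded_measurable_cst (c : R) : bounded_measurable (fun=> c).
Proof. by split=> //; exists `|c|. Qed.

Lemma bounded_measurable_integrable f : bounded_measurable f ->
  mu.-integrable I01 (EFin \o f).
Proof. by move=> [mf [M fM]]; exact: bounded_integrable fM. Qed.

Variable psi : nat -> R -> R.
Hypothesis mpsi : forall k, measurable_fun setT (psi k).
Hypothesis bpsi : forall k, exists M, forall x, `|psi k x| <= M.
Hypothesis psi_mean : forall k, (\int[mu]_(x in I01) psi k x = 0)%R.
Hypothesis psi_orth : forall j k, j != k ->
  (\int[mu]_(x in I01) (psi j x * psi k x) = 0)%R.
(** An inequality, since some [psi k] will be the zero function. *)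
Hypothesis psi_norm : forall k, (\int[mu]_(x in I01) (psi k x * psi k x) <= 1)%R.

Let psi_bm k : bounded_measurable (psi k). Proof. by split. Qed.

Variable a : nat -> R.
(** With [a k] equal to [l k * psi k s], this is a partial sum of the section of the density at
    [s]. *)
Definition partial_density n (x : R) := 1 + \sum_(0 <= k < n) a k * psi k x.

Lemma partial_densityS n x :
  partial_density n.+1 x = partial_density n x + a n * psi n x.
Proof. by rewrite /partial_density big_nat_recr//= addrA. Qed.

Lemma partial_density_bm n : bounded_measurable (partial_density n).
Proof.
elim: n => [|n IH].
  rewrite (_ : partial_density 0 = fun=> 1); first exact: bounded_measurable_cst.
  by apply/funext => x; rewrite /partial_density big_nil addr0.
rewrite (_ : partial_density n.+1 = fun x => partial_density n x + a n * psi n x).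
  apply: bounded_measurableD => //; apply: bounded_measurableM => //.
  exact: bounded_measurable_cst.
by apply/funext => x; exact: partial_densityS.
Qed.

(** The partial sum lies in the span of 1 and of the [psi k] with k < n, all orthogonal to
    [psi m]. *)
Lemma partial_density_orth n m : (n <= m)%N ->
  (\int[mu]_(x in I01) (partial_density n x * psi m x) = 0)%R.
Proof.
elim: n => [|n IH] nm.
  under eq_Rintegral do rewrite /partial_density big_nil addr0 mul1r.
  exact: psi_mean.
under eq_Rintegral do rewrite partial_densityS mulrDl -mulrA.
rewrite RintegralD//; last 2 first.
- by apply/bounded_measurable_integrable/bounded_measurableM => //;
    exact: partial_density_bm.
- apply/bounded_measurable_integrable/bounded_measurableM.
    exact: bounded_measurable_cst.
  exact: bounded_measurableM.
rewrite IH ?(ltnW nm)// add0r RintegralZl//.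
  by rewrite psi_orth ?mulr0// ltn_eqF.
by apply/bounded_measurable_integrable/bounded_measurableM.
Qed.

(** Pythagoras, by induction: the cross term vanishes by [partial_density_orth], and the new square
    contributes at most [a n ^+ 2]. *)
Lemma partial_density_sqr n :
  (\int[mu]_(x in I01) (partial_density n x ^+ 2)%:E
   <= (1 + \sum_(0 <= k < n) a k ^+ 2)%:E)%E.
Proof.
have sq_bm m : bounded_measurable (fun x => partial_density m x ^+ 2).
  by apply: bounded_measurableM; exact: partial_density_bm.
rewrite -[leLHS]fineK; last first.
  by apply: integrable_fin_num => //; exact: bounded_measurable_integrable.
rewrite lee_fin -[leLHS]/(Rintegral _ _ _).
elim: n => [|n IH].
  rewrite big_nil addr0; under eq_Rintegral do
    rewrite /partial_density big_nil addr0 expr1n.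
  by rewrite Rintegral_cst// mul1r -[leRHS]/(fine 1%E) -mu01.
under eq_Rintegral => x _.
  rewrite partial_densityS.
  rewrite (_ : _ ^+ 2 = partial_density n x ^+ 2
    + (2 * a n * (partial_density n x * psi n x)
       + a n ^+ 2 * (psi n x * psi n x))); last by ring.
  over.
have bm1 : bounded_measurable (fun x => partial_density n x * psi n x).
  by apply: bounded_measurableM => //; exact: partial_density_bm.
have bm2 : bounded_measurable (fun x => psi n x * psi n x).
  exact: bounded_measurableM.
have bmZ c f : bounded_measurable f -> bounded_measurable (fun x => c * f x).
  by apply: bounded_measurableM; exact: bounded_measurable_cst.
rewrite RintegralD//; last 2 first.
- exact: bounded_measurable_integrable.
- by apply: bounded_measurable_integrable; apply: bounded_measurableD; exact: bmZ.
rewrite RintegralD//; last 2 first.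
- by apply: bounded_measurable_integrable; exact: bmZ.
- by apply: bounded_measurable_integrable; exact: bmZ.
rewrite !RintegralZl//; last 2 first.
- exact: bounded_measurable_integrable.
- exact: bounded_measurable_integrable.
rewrite partial_density_orth// mulr0 add0r big_nat_recr//= addrA.
by rewrite lerD// -[leRHS]mulr1 ler_wpM2l// sqr_ge0.
Qed.

End bessel.

(** * The density and its integrals over rectangles *)

Section kernel_density.
Context (R : realType).
Local Notation mu := (@lebesgue_measure R).
Local Notation I01 := (`[0%R, 1%R]%classic : set R).

Variables (l b : nat -> R) (psi : nat -> R -> R) (T : R).
Hypothesis mpsi : forall k, measurable_fun setT (psi k).
Hypothesis bpsi : forall k, exists M, forall x, `|psi k x| <= M.
Hypothesis b_le : forall k x y, b k <= l k * psi k x * psi k y.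
Hypothesis b_le0 : forall k, b k <= 0.
Hypothesis T_ge0 : 0 <= T.
(** So [T] is 1 + sum_k b_k; the sign change gives a series of nonnegative terms with finite sum. *)
Hypothesis sum_b : (\sum_(k <oo) (- b k)%:E = (1 - T)%:E)%E.
Hypothesis psi_mean : forall k, (\int[mu]_(x in I01) psi k x = 0)%R.

Local Notation J k A := (\int[mu]_(x in A) psi k x)%R.

(* Since sum_b holds, this is 1 + sum_k l_k psi_k(s) psi_k(t), wherever that
   series converges; it is +oo elsewhere. *)
Definition kdens (z : measurableTypeR R * measurableTypeR R) : \bar R :=
  (T%:E + \sum_(k <oo) (l k * psi k z.1 * psi k z.2 - b k)%:E)%E.

Lemma kdens_ge0 z : (0 <= kdens z)%E.
Proof.
rewrite /kdens adde_ge0 ?lee_fin//; apply: nneseries_ge0 => k _ _.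
by rewrite lee_fin subr_ge0.
Qed.

Lemma measurable_kdens : measurable_fun setT kdens.
Proof.
apply: emeasurable_funD => //; apply: ge0_emeasurable_sum => // [k z _ _|k _].
  by rewrite lee_fin subr_ge0.
apply/measurable_EFinP; apply: measurable_funB => //.
apply: measurable_funM.
  by apply: measurable_funM => //; exact: (measurableT_comp (mpsi k) measurable_fst).
exact: (measurableT_comp (mpsi k) measurable_snd).
Qed.

Lemma measurable_kdens2 s (A : set R) :
  measurable_fun A (fun t => kdens (s, t)).
Proof.
apply: measurable_funTS.
exact: (measurable_fun_pair2 s measurable_kdens).
Qed.

(** For fixed [s] each term is affine in [psi k t], with slope [l k * psi k s] and constant
    [- b k]. *)
Lemma integral_kdens s (A : set R) : measurable A -> A `<=` I01 ->
  (\int[mu]_(t in A) kdens (s, t) =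
   (T * fine (mu A))%:E
   + \sum_(k <oo) (l k * J k A * psi k s - b k * fine (mu A))%:E)%E.
Proof.
move=> mA AI; rewrite /kdens/=.
have muA : mu A \is a fin_num by rewrite ge0_fin_numE// mu_sub01.
rewrite (@integral_affine_series _ _ mpsi bpsi _
  (fun k => l k * psi k s) (fun k => - b k))//; last first.
  by move=> k x _; rewrite subr_ge0.
rewrite EFinM fineK//; congr (_ + _)%E.
by apply: eq_eseriesr => k _; congr EFin; ring.
Qed.

(** The zero means leave only T + sum_k (- b_k) = T + (1 - T). *)
Lemma integral_kdens01 s : (\int[mu]_(t in I01) kdens (s, t) = 1)%E.
Proof.
rewrite integral_kdens// mu01/=.
under eq_eseriesr do rewrite psi_mean mulr0 mul0r mulr1 sub0r.
by rewrite sum_b -EFinD; congr EFin; ring.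
Qed.

(** This is the integral over [B] of the nonnegative k-th term of [kdens]; the sign permits a second
    termwise integration, in [s]. *)
Lemma section_coef_ge0 k s (B : set R) : measurable B -> B `<=` I01 ->
  0 <= l k * J k B * psi k s - b k * fine (mu B).
Proof.
move=> mB BI; rewrite -lee_fin.
have -> : ((l k * J k B * psi k s - b k * fine (mu B))%:E =
   \int[mu]_(t in B) (l k * psi k s * psi k t - b k)%:E)%E.
  by rewrite integral_affine//; congr EFin; ring.
by apply: integral_ge0 => t _; rewrite lee_fin subr_ge0.
Qed.

Lemma integral_kdens_rect (A B : set R) : measurable A -> A `<=` I01 ->
  measurable B -> B `<=` I01 ->
  (\int[mu]_(s in A) \int[mu]_(t in B) kdens (s, t) =
   (T * fine (mu A) * fine (mu B))%:E
   + \sum_(k <oo) (l k * J k A * J k B - b k * fine (mu A) * fine (mu B))%:E)%E.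
Proof.
move=> mA AI mB BI.
have muA : mu A \is a fin_num by rewrite ge0_fin_numE// mu_sub01.
under eq_integral do rewrite integral_kdens//.
rewrite (@integral_affine_series _ _ mpsi bpsi _ (fun k => l k * J k B)
  (fun k => - (b k * fine (mu B))))//.
- rewrite -[X in (_ * X)%E]fineK// -EFinM; congr (EFin _ + _)%E; first ring.
  by apply: eq_eseriesr => k _; congr EFin; ring.
- by rewrite mulr_ge0// fine_ge0.
- by move=> k s _; exact: section_coef_ge0.
Qed.

(** Enlarging [B] to [0, 1] makes the inner integral 1, so the double integral is at most [mu A],
    which is finite and dominates the series. *)
Lemma rect_series_lty (A B : set R) : measurable A -> A `<=` I01 ->
  measurable B -> B `<=` I01 ->
  (\sum_(k <oo) (l k * J k A * J k B - b k * fine (mu A) * fine (mu B))%:E < +oo)%E.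
Proof.
move=> mA AI mB BI.
suff : (\int[mu]_(s in A) \int[mu]_(t in B) kdens (s, t) < +oo)%E.
  rewrite integral_kdens_rect//; apply: le_lt_trans.
  by rewrite leeDr// lee_fin !mulr_ge0// fine_ge0.
apply: (@le_lt_trans _ _ (\int[mu]_(s in A) 1)%E).
  apply: ge0_le_integral => //.
  - by move=> s _; apply: integral_ge0 => t _; exact: kdens_ge0.
  - under eq_fun do rewrite integral_kdens//.
    apply: emeasurable_funD => //; apply: ge0_emeasurable_sum => // [k s _ _|k _].
      by rewrite lee_fin section_coef_ge0.
    exact: affine_measurable.
  - move=> s _; rewrite -(integral_kdens01 s); apply: ge0_subset_integral => //.
    + exact: measurable_kdens2.
    + by move=> t _; exact: kdens_ge0.
by rewrite integral_cst// mul1e mu_sub01.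
Qed.

Lemma kdens_fin_num s : {ae mu, forall t, I01 t -> kdens (s, t) \is a fin_num}.
Proof.
apply: integrable_ae => //; apply/integrableP; split.
  exact: measurable_kdens2.
under eq_integral do rewrite gee0_abs ?kdens_ge0//.
by rewrite integral_kdens01 ltry.
Qed.

(** [fine] changes the section only where it is +oo, a null set because its integral over [0, 1] is
    1. *)
Lemma integral_fine_kdens s (A : set R) : measurable A -> A `<=` I01 ->
  (\int[mu]_(t in A) (fine (kdens (s, t)))%:E = \int[mu]_(t in A) kdens (s, t))%E.
Proof.
move=> mA AI; apply: ge0_ae_eq_integral => //.
- apply/measurable_EFinP; apply: measurableT_comp => //.
  exact: measurable_kdens2.
- exact: measurable_kdens2.
- by move=> t _; rewrite lee_fin fine_ge0// kdens_ge0.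
- by move=> t _; exact: kdens_ge0.
- move: (kdens_fin_num s); apply: filterS; first exact: (ae_filter_ringOfSetsType mu).
  move=> t fin_t At; rewrite fineK//.
  exact/fin_t/AI.
Qed.

(** The series without the shift by [b k] is the difference of two series of nonnegative terms with
    finite sums. *)
Lemma kdens_rect_cvg (A B : set R) : measurable A -> A `<=` I01 ->
  measurable B -> B `<=` I01 ->
  exists2 r : R,
    (\sum_(0 <= k < n) l k * J k A * J k B)%R @[n --> \oo] --> r
  & (\int[mu]_(s in A) \int[mu]_(t in B) kdens (s, t) =
     (fine (mu A) * fine (mu B) + r)%:E)%E.
Proof.
move=> mA AI mB BI.
have := rect_series_lty mA AI mB BI.
rewrite integral_kdens_rect//.
set m := fine (mu A) * fine (mu B).
set x := (fun k => l k * J k A * J k B - b k * fine (mu A) * fine (mu B)).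
have x_ge0 k : 0 <= x k.
  rewrite -lee_fin.
  have -> : (x k)%:E = (\int[mu]_(s in A)
      (l k * J k B * psi k s + - (b k * fine (mu B)))%:E)%E.
    by rewrite integral_affine// /x; congr EFin; ring.
  by apply: integral_ge0 => s _; rewrite lee_fin section_coef_ge0.
move=> x_fin.
have [q qE] : exists q : R, (\sum_(k <oo) (x k)%:E = q%:E)%E.
  exists (fine (\sum_(k <oo) (x k)%:E)%E); rewrite fineK// ge0_fin_numE//.
  by apply: nneseries_ge0 => k _ _; rewrite lee_fin.
(* The shifts by [- b k * m] add up to (1 - T) m, and T m + q = m + (q - (1 - T) m). *)
exists (q - (1 - T) * m); last by rewrite qE -EFinD /m; congr EFin; ring.
rewrite (_ : (fun n => _) = (fun n => \sum_(0 <= k < n) x k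
    - (\sum_(0 <= k < n) - b k) * m)); last first.
  apply/funext => n; rewrite mulr_suml -sumrB; apply: eq_bigr => k _.
  by rewrite /x /m; ring.
apply: cvgB; first exact: nneseries_cvg.
apply: cvgMl; apply: nneseries_cvg => // k; first by rewrite oppr_ge0.
Qed.

(** * The law on the plane and its uniform marginals *)

Definition square01 : set (measurableTypeR R * measurableTypeR R) := I01 `*` I01.

Definition kdens_law (X : set (measurableTypeR R * measurableTypeR R)) : \bar R :=
  (\int[mu \x mu]_(z in X) (kdens \_ square01) z)%E.

(** Tonelli's theorem, once the two restrictions are merged into one to a product of subsets of
    [0, 1]. *)
Lemma kdens_law_rect (A B : set (measurableTypeR R)) :
  measurable A -> measurable B ->
  (kdens_law (A `*` B) =
   \int[mu]_(s in A `&` I01) \int[mu]_(t in B `&` I01) kdens (s, t))%E.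
Proof.
move=> mA mB.
have mI : measurable (I01 : set (measurableTypeR R)) by exact: measurable_itv.
have mAI : measurable (A `&` I01) by exact: measurableI.
have mBI : measurable (B `&` I01) by exact: measurableI.
rewrite /kdens_law -integral_mkcondr.
rewrite (_ : _ `&` square01 = (A `&` I01) `*` (B `&` I01)); last first.
  by apply/seteqP; split=> -[x y] /=; rewrite /square01 /=; tauto.
rewrite integral_mkcond fubini_tonelli1; last 2 first.
- apply/(measurable_restrictT _ _).1; first exact: measurableX.
  exact: measurable_funTS measurable_kdens.
- by move=> z; apply: erestrict_ge0 => w _; exact: kdens_ge0.
rewrite [RHS]integral_mkcond; apply: eq_integral => s _ /=.
rewrite /fubini_F patchE; case: ifPn => sA.
  rewrite [RHS]integral_mkcond; apply: eq_integral => t _.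
  by rewrite !patchE in_setX sA.
by apply: integral0_eq => t _; rewrite patchE in_setX (negbTE sA).
Qed.

Lemma measurable_kdens_square01 : measurable_fun setT (kdens \_ square01).
Proof.
apply/(measurable_restrictT _ _).1; last exact: measurable_funTS measurable_kdens.
by apply: measurableX; exact: measurable_itv.
Qed.

Lemma kdens_law_probability :
  exists P : probability (measurableTypeR R * measurableTypeR R)%type R,
    forall X, P X = kdens_law X.
Proof.
apply: density_probability.
- exact: measurable_kdens_square01.
- by move=> z; apply: erestrict_ge0 => w _; exact: kdens_ge0.
(* The plane is itself a rectangle, and every section has integral 1. *)
- have := kdens_law_rect measurableT measurableT.
  rewrite setXTT !setTI /kdens_law => ->.
  under eq_integral do rewrite integral_kdens01.
  by rewrite integral_cst//= mul1e mu01.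
Qed.

Lemma uniform_prob01 (A : set (measurableTypeR R)) : measurable A ->
  uniform_prob (@ltr01 R) A = mu (A `&` I01).
Proof.
move=> mA; rewrite /uniform_prob integral_uniform_pdf.
rewrite (eq_integral (fun=> 1%E)); last first.
  move=> x; rewrite inE/= in_itv/= /uniform_pdf => -[_ ->].
  by rewrite subr0 invr1.
by rewrite integral_cst ?mul1e//; exact: measurableI.
Qed.

Lemma kdens_copula (C : R -> R -> R) :
  (forall u v : R, u \in `[0, 1] -> v \in `[0, 1] ->
    (C u v)%:E = (\int[mu]_(s in `[0%R, u]) \int[mu]_(t in `[0%R, v])
                    kdens (s, t))%E) ->
  is_copula C.
Proof.
move=> CE; have [P PE] := kdens_law_probability.
have mI : measurable (I01 : set (measurableTypeR R)) by exact: measurable_itv.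
have I_fin : mu I01 \is a fin_num by rewrite mu01.
have fin (A : set R) : measurable A -> mu (A `&` I01) \is a fin_num.
  by move=> mA; rewrite ge0_fin_numE// mu_sub01//; exact: measurableI.
exists P; split.
- move=> A mA; rewrite /pushforward PE uniform_prob01//.
  rewrite (_ : fst @^-1` A = A `*` setT); last first.
    by apply/seteqP; split => -[x y] /=; tauto.
  rewrite kdens_law_rect// setTI.
  under eq_integral do rewrite integral_kdens01.
  by rewrite integral_cst ?mul1e//; exact: measurableI.
- move=> A mA; rewrite /pushforward PE uniform_prob01//.
  rewrite (_ : snd @^-1` A = setT `*` A); last first.
    by apply/seteqP; split => -[x y] /=; tauto.
  have mAI : measurable (A `&` I01) by exact: measurableI.
  have AI : A `&` I01 `<=` I01 by move=> x [].
  (* The unit integral is known for integration in [t] only. Here the rectangle formula is used: the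
     mean of [psi k] in [s] is zero, which leaves T m + (1 - T) m = m. *)
  rewrite kdens_law_rect// setTI integral_kdens_rect// mu01/= -[RHS]fineK ?fin//.
  set m := fine _.
  under eq_eseriesr => k _ do
    rewrite psi_mean mulr0 mul0r mulr1 sub0r -mulNr mulrC EFinM.
  rewrite nneseriesZl; last by move=> k _; rewrite lee_fin oppr_ge0.
  by rewrite sum_b -EFinM -EFinD; congr EFin; ring.
(* The law lives on the unit square, so the quadrant may be cut down to [0, u] x [0, v]. *)
- move=> u v u01 v01; rewrite PE kdens_law_rect// CE//.
  have itvE (w : R) : w \in `[0, 1] ->
      (`]-oo, w] `&` I01 = `[0%R, w] :> set R)%classic.
    rewrite in_itv/= => /andP[w0 w1]; apply/seteqP; split => x /=;
    by rewrite !in_itv/=; lra.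
  by rewrite !itvE.
Qed.

(** * Square integrability of the density *)

Hypothesis psi_orth : forall j k, j != k ->
  (\int[mu]_(x in I01) (psi j x * psi k x) = 0)%R.
Hypothesis psi_norm : forall k, (\int[mu]_(x in I01) (psi k x * psi k x) <= 1)%R.
Hypothesis l_sqr : (\sum_(k <oo) ((l k) ^+ 2)%:E < +oo)%E.

(** The splitting of [kdens_rect_cvg], now pointwise: finiteness of [kdens] makes the shifted series
    converge, and the shifts are summable. *)
Lemma partial_density_cvg s t : kdens (s, t) \is a fin_num ->
  partial_density psi (fun k => l k * psi k s) n t @[n --> \oo] -->
  fine (kdens (s, t)).
Proof.
move=> fin_st.
have x_ge0 k : 0 <= l k * psi k s * psi k t - b k by rewrite subr_ge0.
have [q qE] : exists q : R,
    (\sum_(k <oo) (l k * psi k s * psi k t - b k)%:E = q%:E)%E.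
  exists (fine (\sum_(k <oo) (l k * psi k s * psi k t - b k)%:E)%E).
  by move: fin_st; rewrite /kdens/= fin_numD => /andP[_ /fineK].
have -> : fine (kdens (s, t)) = 1 + (q - (1 - T)).
  by rewrite /kdens/= qE/=; ring.
rewrite (_ : (fun n => _) = (fun n =>
    1 + (\sum_(0 <= k < n) (l k * psi k s * psi k t - b k)
    - \sum_(0 <= k < n) - b k))); last first.
  apply/funext => n; rewrite /partial_density -sumrB; congr (_ + _).
  by apply: eq_bigr => k _; ring.
apply: cvgD; first exact: cvg_cst.
apply: cvgB; apply: nneseries_cvg => // k.
by rewrite oppr_ge0.
Qed.

Lemma measurable_fine_kdens : measurable_fun setT (fine \o kdens).
Proof. by apply: measurableT_comp => //; exact: measurable_kdens. Qed.

Lemma integral_kdens_sqr s :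
  (\int[mu]_(t in I01) (fine (kdens (s, t)) ^+ 2)%:E <=
   1%:E + \sum_(k <oo) ((l k * psi k s) ^+ 2)%:E)%E.
Proof.
apply: (@le_integral_ae_cvg _ (measurableTypeR R) R mu I01
  (fun n t => (partial_density psi (fun k => l k * psi k s) n t ^+ 2)%:E)) => //.
- move=> n; apply/measurable_EFinP/measurable_funTS; apply: measurable_funX.
  by have [] := partial_density_bm mpsi bpsi (fun k => l k * psi k s) n.
- apply/measurable_EFinP/measurable_funTS; apply: measurable_funX.
  exact: (measurable_fun_pair2 s measurable_fine_kdens).
- by move=> n t _; rewrite lee_fin sqr_ge0.
- by move=> t _; rewrite lee_fin sqr_ge0.
- move: (kdens_fin_num s); apply: filterS; first exact: (ae_filter_ringOfSetsType mu).
  move=> t fin_t It; apply: cvg_EFin; first exact: nearW.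
  have h := partial_density_cvg (fin_t It).
  under eq_fun do rewrite /= expr2.
  by rewrite expr2; exact: cvgM.
- move=> n.
  apply: le_trans (partial_density_sqr mpsi bpsi psi_mean psi_orth psi_norm _ n) _.
  rewrite EFinD leeD2l// -sumEFin.
  by apply: nneseries_lim_ge => k _ _; rewrite lee_fin sqr_ge0.
Qed.

Lemma kdens_square_integrable :
  square_integrable_density (fine \o kdens).
Proof.
rewrite /square_integrable_density.
have mI : measurable (I01 : set (measurableTypeR R)) by exact: measurable_itv.
have msq : measurable_fun setT (fun z => (fine (kdens z) ^+ 2)%:E).
  by apply/measurable_EFinP; apply: measurable_funX; exact: measurable_fine_kdens.
have mpsi2 k : measurable_fun I01 (fun s => ((l k * psi k s) ^+ 2)%:E).
  apply/measurable_EFinP/measurable_funTS/measurable_funX.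
  exact: measurable_funM.
apply: (@le_lt_trans _ _
  (\int[mu]_(s in I01) (1%:E + \sum_(k <oo) ((l k * psi k s) ^+ 2)%:E))%E).
  apply: ge0_le_integral => //.
  - by move=> s _; apply: integral_ge0 => t _; rewrite lee_fin sqr_ge0.
  - apply: measurable_funTS.
    (* Restriction to a strip turns the inner integral into one over the whole line, whose
       measurability in [s] is part of Tonelli's theorem. *)
    pose h := (fun z => (fine (kdens z) ^+ 2)%:E) \_ (setT `*` I01).
    rewrite (_ : (fun s => _) = fubini_F mu h); last first.
      apply/funext => s; rewrite integral_mkcond; apply: eq_integral => t _.
      by rewrite /h !patchE in_setX in_setT.
    apply: measurable_fun_fubini_tonelli_F.
      apply/(measurable_restrictT _ _).1; last exact: measurable_funTS.
      exact: measurableX.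
    by move=> z; apply: erestrict_ge0 => w _; rewrite lee_fin sqr_ge0.
  - apply: emeasurable_funD => //; apply: ge0_emeasurable_sum => //.
      by move=> k s _ _; rewrite lee_fin sqr_ge0.
    by move=> k _; exact: mpsi2.
  - by move=> s _; exact: integral_kdens_sqr.
rewrite ge0_integralD//; last 2 first.
- by move=> s _; apply: nneseries_ge0 => k _ _; rewrite lee_fin sqr_ge0.
- apply: ge0_emeasurable_sum => //.
    by move=> k s _ _; rewrite lee_fin sqr_ge0.
  by move=> k _; exact: mpsi2.
rewrite integral_cst// [X in (X + _)%E](_ : _ = 1%E); last first.
  by rewrite mul1e; exact: mu01.
rewrite integral_nneseries//; last first.
  by move=> k s _; rewrite lee_fin sqr_ge0.
apply: lte_add_pinfty; first exact: ltry.
(* Each term integrates to l_k^2 times the integral of psi_k^2, hence to at most l_k^2. *)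
apply: le_lt_trans l_sqr; apply: lee_nneseries => k _.
  by move=> _; apply: integral_ge0 => s _; rewrite lee_fin sqr_ge0.
have int2 : mu.-integrable I01 (EFin \o (fun s => psi k s * psi k s)).
  by apply/bounded_measurable_integrable/bounded_measurableM; split.
have fin2 : (\int[mu]_(s in I01) (psi k s * psi k s)%:E)%E \is a fin_num.
  by apply: integrable_fin_num => //; exact: int2.
rewrite (_ : (fun s => _) = fun s => ((l k ^+ 2)%:E * (psi k s * psi k s)%:E)%E).
  rewrite integralZl// -[leRHS]mule1; apply: lee_wpmul2l.
    by rewrite lee_fin sqr_ge0.
  rewrite -(fineK fin2) lee_fin; exact: psi_norm.
by apply/funext => s; rewrite -EFinM; congr EFin; ring.
Qed.

End kernel_density.

(** * Sign and bounds coming from the extrema *)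

Section extrema.
Context (R : realType).
Local Notation J01 := (`]0%R, 1%R[%classic : set R).
Local Notation mu := (@lebesgue_measure R).
Local Notation I01 := (`[0%R, 1%R]%classic : set R).

Lemma max01E (f : R -> R) x : x \in `[0, 1] ->
  (forall y, y \in `[0, 1] -> f y <= f x) -> max01 f = f x.
Proof.
move=> x01 fx; apply/eqP; rewrite eq_le; apply/andP; split.
  apply: ge_sup; first by exists (f x), x.
  by move=> _ [y y01 <-]; exact: fx.
apply: ub_le_sup; last by exists x.
by exists (f x) => _ [y y01 <-]; exact: fx.
Qed.

Lemma min01E (f : R -> R) x : x \in `[0, 1] ->
  (forall y, y \in `[0, 1] -> f x <= f y) -> min01 f = f x.
Proof.
move=> x01 fx; apply/eqP; rewrite eq_le; apply/andP; split.
  apply: ge_inf; last by exists x.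
  by exists (f x) => _ [y y01 <-]; exact: fx.
apply: lb_le_inf; first by exists (f x), x.
by move=> _ [y y01 <-]; exact: fx.
Qed.

(** Links orthonormality, stated on the open interval, to the closed interval of the extrema; the
    endpoints are null. *)
Lemma Rintegral_itv_oo_cc (f : R -> R) : measurable_fun J01 f ->
  (\int[mu]_(x in J01) f x = \int[mu]_(x in I01) f x)%R.
Proof.
move=> mf; rewrite /Rintegral integral_itv_obnd_cbnd; last exact/measurable_EFinP.
rewrite integral_itv_bndo_bndc//; apply/measurable_EFinP.
apply: measurable_funS (measurable_fun_itv_cc mf) => //.
by apply: subset_itvl; rewrite bnd_simp.
Qed.

(** A lower bound is at most the mean. Used for [f] and for its opposite, it yields min f <= 0 <=
    max f. *)
Lemma mean0_bound_le0 (f : R -> R) (M c : R) : measurable_fun I01 f ->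
  (forall x, x \in `[0, 1] -> `|f x| <= M) ->
  (\int[mu]_(x in I01) f x = 0)%R ->
  (forall x, x \in `[0, 1] -> c <= f x) -> c <= 0.
Proof.
move=> mf fM f0 cf; rewrite -f0.
have muI : fine (mu I01) = 1 by rewrite mu01.
rewrite -[c]mulr1 -[in leLHS]muI -Rintegral_cst//; apply: le_Rintegral => //.
- by apply: (@bounded_integrable _ _ (cst c) `|c|) => //=.
- apply: measurable_bounded_integrable => //; first exact: mu_sub01.
  by exists M; split=> [|N /ltW MN x xI]; rewrite ?num_real//;
    exact: le_trans (fM _ xI) MN.
Qed.

(** For [lam] > 0 the point is that a product of two values of [f] is at least min f max f; for
    [lam] < 0, that it is at most max f^2. *)
Lemma alpha_bounds (lam : R) (f : R -> R) : lam != 0 -> extrema_exist lam f ->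
  measurable_fun I01 f -> (\int[mu]_(x in I01) f x = 0)%R ->
  [/\ exists M, forall x, x \in `[0, 1] -> `|f x| <= M,
      lam * alpha lam f <= 0
    & forall x y, x \in `[0, 1] -> y \in `[0, 1] ->
        lam * alpha lam f <= lam * f x * f y].
Proof.
move=> lam0 [neg pos] mf f0; have [lamn|] := ltP lam 0; last first.
  rewrite le_eqVlt eq_sym (negbTE lam0) => /= lamp.
  have [[m m01 fm] [M M01 fM]] := pos lamp.
  have fb x : x \in `[0, 1] -> `|f x| <= Num.max `|f m| `|f M|.
    move=> x01; rewrite le_max; have := fm _ x01; have := fM _ x01.
    case: (leP 0 (f x)) => [fx0 fxM _|fx0 _ fmx].
      by apply/orP; right; rewrite ger0_norm// (le_trans fxM)// ler_norm.
    by apply/orP; left; rewrite ltr0_norm// -(normrN (f m));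
      rewrite (le_trans _ (ler_norm _))// lerN2.
  rewrite /alpha ltNge (ltW lamp)/= (max01E M01 fM) (min01E m01 fm).
  have m0 : f m <= 0 by apply: mean0_bound_le0 fb f0 fm.
  have M0 : 0 <= f M.
    rewrite -oppr_le0; apply: (@mean0_bound_le0 (fun x => - f x) _ _ _ _ _ _).
    - exact: measurableT_comp.
    - by move=> x x01; rewrite normrN; exact: fb.
    - rewrite (_ : (fun x => - f x) = (fun x => -1 * f x)); last first.
        by apply/funext => x; rewrite mulN1r.
      rewrite RintegralZl// ?f0 ?mulr0//.
      apply: measurable_bounded_integrable => //; first exact: mu_sub01.
      by exists (Num.max `|f m| `|f M|); split=> [|N /ltW MN x xI];
        rewrite ?num_real//;
        exact: le_trans (fb _ xI) MN.
    - by move=> x x01; rewrite lerN2 fM.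
  split.
  - by exists (Num.max `|f m| `|f M|).
  - by rewrite pmulr_rle0// mulr_le0_ge0.
  - move=> x y x01 y01; rewrite -mulrA ler_pM2l//.
    move: (fm _ x01) (fM _ x01) (fm _ y01) (fM _ y01).
    move: (f m) (f M) (f x) (f y) m0 M0 => p q a c p0 q0 pa aq pc cq.
    (* Values of equal sign have a product >= 0 >= p q. For opposite signs, replace the nonnegative
       value by [q] and the negative one by [p]. *)
    have [a0|a0] := leP 0 a; have [c0|c0] := leP 0 c.
    - by rewrite (@le_trans _ _ 0) ?mulr_ge0 ?mulr_le0_ge0.
    - rewrite [leRHS]mulrC (@le_trans _ _ (p * a))//.
        by rewrite ler_wnM2l.
      by rewrite ler_wpM2r.
    - rewrite (@le_trans _ _ (p * c))//; first by rewrite ler_wnM2l.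
      by rewrite ler_wpM2r.
    - by rewrite (@le_trans _ _ 0) ?mulr_le0_ge0// nmulr_rge0// ltW.
have [M M01 fM] := neg lamn.
rewrite /alpha lamn (max01E M01 fM); split.
- exists `|f M| => x x01; rewrite -ler_sqr ?nnegrE//.
  by rewrite !real_normK ?num_real// fM.
- by rewrite mulr_le0_ge0 ?sqr_ge0// ltW.
- move=> x y x01 y01; rewrite -mulrA ler_nM2l//.
  (* The product is at most the mean of the two squares, each at most the maximum. *)
  by move: (fM _ x01) (fM _ y01) (sqr_ge0 (f x - f y)) => /=; lra.
Qed.

End extrema.

(** * Reindexing, and the constant term of the density *)

Lemma eseries_from2 (R : realType) (f : nat -> R) :
  (\sum_(2 <= k <oo) (f k)%:E
   = \sum_(k <oo) (if (1 < k)%N then f k else 0)%:E)%E.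
Proof.
rewrite eseries_cond eseries_mkcond; apply: eq_eseriesr => k _.
by rewrite andTb; case: ifP.
Qed.

(** The sum of the [b k] lies in [-oo, 0] and the hypothesis excludes -oo; hence it is some real -s,
    and T = 1 - s. *)
Lemma npeseries_affine (R : realType) (b : nat -> R) : (forall k, b k <= 0) ->
  (0 <= 1 + \sum_(k <oo) (b k)%:E)%E ->
  exists2 T, 0 <= T & (\sum_(k <oo) (- b k)%:E = (1 - T)%:E)%E.
Proof.
move=> b0.
rewrite (_ : \sum_(k <oo) (b k)%:E = - \sum_(k <oo) (- b k)%:E)%E; last first.
  rewrite -limeN; last by apply: is_cvg_nneseries => k _ _; rewrite lee_fin oppr_ge0.
  apply: congr_lim; apply/funext => n /=.
  by rewrite !sumEFin -EFinN sumrN opprK.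
have : (0 <= \sum_(k <oo) (- b k)%:E)%E.
  by apply: nneseries_ge0 => k _ _; rewrite lee_fin oppr_ge0.
case: (\sum_(k <oo) (- b k)%:E)%E => [s|//|//] _.
rewrite -EFinN -EFinD lee_fin => s1.
by exists (1 - s) => //; congr EFin; ring.
Qed.

(** * From the orthonormal system to the kernel *)

Theorem theorem2p3 (R : realType) (phi : nat -> R -> R) (lambda : nat -> R)
  (hphi : orthonormal_system phi)
  (hphi1 : {ae @lebesgue_measure R, forall x : R, x \in `]0, 1[ -> phi 1%N x = 1})
  (hlambda : (\sum_(2 <= k <oo) ((lambda k) ^+ 2)%:E < +oo)%E)
  (hext : forall k, (1 < k)%N -> extrema_exist (lambda k) (phi k))
  (halpha : (0 <= 1 + \sum_(2 <= k <oo) (lambda k * alpha (lambda k) (phi k))%:E)%E) :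
  (forall u v : R, u \in `[0, 1] -> v \in `[0, 1] ->
     cvgn (fun n => \sum_(2 <= k < n) Cterm phi lambda u v k)) /\
  [/\ is_copula (Cfun phi lambda),
      symmetric01 (Cfun phi lambda)
    & exists c, has_density (Cfun phi lambda) c /\ square_integrable_density c].
Proof.
pose mu := @lebesgue_measure R.
pose I01 : set R := `[0%R, 1%R]%classic.
pose J01 : set R := `]0%R, 1%R[%classic.
have mI : measurable I01 by exact: measurable_itv.
have [hL2 horth] := hphi.
have mphi k : (1 <= k)%N -> measurable_fun J01 (phi k) by move=> /hL2[].
have mphiI k : (1 <= k)%N -> measurable_fun I01 (phi k).
  by move=> /mphi/measurable_fun_itv_cc.
(* Orthogonality to [phi 1], which equals 1 almost everywhere. *)
have mean0 k : (1 < k)%N -> (\int[mu]_(x in I01) phi k x = 0)%R.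
  move=> k1; have k0 := ltnW k1.
  rewrite -Rintegral_itv_oo_cc; last exact: mphi.
  have := horth 1%N k isT k0; rewrite (ltn_eqF k1) => orth1k.
  transitivity (\int[mu]_(x in J01) (phi 1%N x * phi k x))%R; last exact: orth1k.
  congr fine; apply: ae_eq_integral => //.
  - by apply/measurable_EFinP; exact: mphi.
  - by apply/measurable_EFinP/measurable_funM; exact: mphi.
  - move: hphi1; apply: filterS; first exact: (ae_filter_ringOfSetsType mu).
    by move=> x phi1 xJ; rewrite phi1 ?mul1r.
(* Where lambda_k = 0 no extrema are assumed and [phi k] may be unbounded, so [psi k] is taken to be
   zero there. Indices 0 and 1 are likewise made void, so that series can start at 0. *)
pose act k := (1 < k)%N && (lambda k != 0).
pose psi k := if act k then phi k \_ I01 else cst 0.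
pose l k := if (1 < k)%N then lambda k else 0.
pose b k := if (1 < k)%N then lambda k * alpha (lambda k) (phi k) else 0.
have bounds k : act k ->
    [/\ exists M, forall x, x \in `[0, 1] -> `|phi k x| <= M,
      lambda k * alpha (lambda k) (phi k) <= 0
    & forall x y, x \in `[0, 1] -> y \in `[0, 1] ->
        lambda k * alpha (lambda k) (phi k) <= lambda k * phi k x * phi k y].
  move=> /andP[k1 lk0]; apply: alpha_bounds => //.
  - exact: hext.
  - exact: mphiI (ltnW k1).
  - exact: mean0.
have psi_act k x : act k -> x \in `[0, 1] -> psi k x = phi k x.
  by move=> ak x01; rewrite /psi ak patchE mem_set.
have psi_out k x : x \notin `[0, 1] -> psi k x = 0.
  move=> x01; rewrite /psi; case: ifP => // _; rewrite patchE memNset//.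
  exact/negP.
have psi_nact k x : ~~ act k -> psi k x = 0 by rewrite /psi => /negbTE ->.
have b_nact k : ~~ act k -> b k = 0.
  by rewrite /b /act; case: ifP => // _ /=; rewrite negbK => /eqP ->; rewrite mul0r.
have mpsi k : measurable_fun setT (psi k).
  rewrite /psi; case: ifP => // /andP[k1 _].
  exact: (measurable_restrictT (phi k) mI).1 (mphiI _ (ltnW k1)).
have bpsi k : exists M, forall x, `|psi k x| <= M.
  have [ak|nak] := boolP (act k); last first.
    by exists 0 => x; rewrite psi_nact// normr0.
  have [[M fM] _ _] := bounds _ ak; exists `|M| => x.
  have [x01|x01] := boolP (x \in `[0, 1]); last by rewrite psi_out// normr0.
  by rewrite psi_act// (le_trans (fM _ x01))// ler_norm.
have b_le0 k : b k <= 0.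
  have [ak|nak] := boolP (act k); last by rewrite b_nact.
  by rewrite /b; case: ifP => // _; have [] := bounds _ ak.
(* This holds on the whole plane: off the square, or for inactive k, the right side is 0 and [b k]
   <= 0. *)
have b_le k x y : b k <= l k * psi k x * psi k y.
  have [ak|nak] := boolP (act k); last by rewrite b_nact// psi_nact// mulr0 mul0r.
  have [x01|x01] := boolP (x \in `[0, 1]); last first.
    by rewrite [psi k x]psi_out// mulr0 mul0r b_le0.
  have [y01|y01] := boolP (y \in `[0, 1]); last first.
    by rewrite [psi k y]psi_out// mulr0 b_le0.
  have [_ _ bd] := bounds _ ak; have /andP[k1 _] := ak.
  by rewrite /b /l k1 !psi_act// bd.
have [T T_ge0 sum_b] : exists2 T, 0 <= T &
    (\sum_(k <oo) (- b k)%:E = (1 - T)%:E)%E.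
  by apply: npeseries_affine => //; rewrite /b -eseries_from2.
have psi_mean k : (\int[mu]_(x in I01) psi k x = 0)%R.
  have [ak|nak] := boolP (act k); last first.
    under eq_Rintegral do rewrite psi_nact//.
    by rewrite Rintegral_cst// mul0r.
  have /andP[k1 _] := ak; rewrite -(mean0 _ k1); apply: eq_Rintegral => x.
  by rewrite inE => x01; exact: psi_act.
have psi_prod j k : (\int[mu]_(x in I01) (psi j x * psi k x)
    = (act j && act k && (j == k))%:R)%R.
  have [aj|naj] := boolP (act j); last first.
    under eq_Rintegral do rewrite psi_nact// mul0r.
    by rewrite Rintegral_cst// mul0r.
  have [ak|nak] := boolP (act k); last first.
    under eq_Rintegral do rewrite [psi k _]psi_nact// mulr0.
    by rewrite Rintegral_cst// mul0r.
  have /andP[/ltnW j1 _] := aj; have /andP[/ltnW k1 _] := ak.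
  rewrite -horth// Rintegral_itv_oo_cc; last by apply: measurable_funM; exact: mphi.
  by apply: eq_Rintegral => x; rewrite inE => x01; rewrite !psi_act.
have psi_orth j k : j != k -> (\int[mu]_(x in I01) (psi j x * psi k x) = 0)%R.
  by rewrite psi_prod => /negbTE ->; rewrite andbF.
have psi_norm k : (\int[mu]_(x in I01) (psi k x * psi k x) <= 1)%R.
  by rewrite psi_prod eqxx andbT andbb; case: (act k).
have l_sqr : (\sum_(k <oo) ((l k) ^+ 2)%:E < +oo)%E.
  move: hlambda; rewrite eseries_from2 /l; congr (_ < _)%E.
  by apply: eq_eseriesr => k _; case: ifP; rewrite ?expr0n.
have subI (u : R) : u \in `[0, 1] -> `[0%R, u]%classic `<=` I01.
  rewrite in_itv/= => /andP[_ u1] x.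
  by rewrite /I01 /= !in_itv/= => /andP[-> /le_trans ->].
have muI (u : R) : u \in `[0, 1] -> fine (mu `[0%R, u]%classic) = u.
  rewrite in_itv/= => /andP[u0 _]; rewrite /mu lebesgue_measure_itv/= lte_fin.
  by move: u0; rewrite le_eqVlt => /predU1P[<-|u0];
    [rewrite ltxx|rewrite u0 /= subr0].
(* For lambda_k = 0 the primitives of [phi k] and [psi k] may differ, but the zero coefficient hides
   it. *)
have termE (u v : R) k : u \in `[0, 1] -> v \in `[0, 1] ->
    l k * (\int[mu]_(x in `[0%R, u]%classic) psi k x)%R
      * (\int[mu]_(x in `[0%R, v]%classic) psi k x)%R
    = if (1 < k)%N then Cterm phi lambda u v k else 0.
  move=> u01 v01; rewrite /l; case: ifP => k1; last by rewrite !mul0r.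
  rewrite /Cterm; have [->|lk0] := eqVneq (lambda k) 0; first by rewrite !mul0r.
  have ak : act k by rewrite /act k1.
  by congr (_ * _ * _); apply: eq_Rintegral => x; rewrite inE => xu;
    apply: psi_act => //; apply: subI xu.
(* The terms of index 0 and 1 on the right vanish by the definition of [l]. *)
have partial_sumE (u v : R) n : u \in `[0, 1] -> v \in `[0, 1] ->
    \sum_(2 <= k < n) Cterm phi lambda u v k =
    \sum_(0 <= k < n) l k * (\int[mu]_(x in `[0%R, u]%classic) psi k x)%R
      * (\int[mu]_(x in `[0%R, v]%classic) psi k x)%R.
  move=> u01 v01; under [RHS]eq_bigr do rewrite termE//.
  by rewrite -big_mkcond/= (@big_nat_widenl _ _ _ 2 0).
have series_cvg (u v : R) : u \in `[0, 1] -> v \in `[0, 1] -> exists2 r,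
    (\sum_(2 <= k < n) Cterm phi lambda u v k)%R @[n --> \oo] --> r
  & (\int[mu]_(s in `[0%R, u]) \int[mu]_(t in `[0%R, v]) kdens l b psi T (s, t)
    = (u * v + r)%:E)%E.
  move=> u01 v01.
  have mI0 (w : R) : measurable (`[0%R, w]%classic : set R) by exact: measurable_itv.
  have [r rcvg rE] := kdens_rect_cvg mpsi bpsi b_le b_le0 T_ge0 sum_b psi_mean
    (mI0 u) (subI _ u01) (mI0 v) (subI _ v01).
  exists r; last by rewrite rE !muI.
  by under eq_fun do rewrite partial_sumE//.
have CE (u v : R) : u \in `[0, 1] -> v \in `[0, 1] ->
    (Cfun phi lambda u v)%:E = (\int[mu]_(s in `[0%R, u])
      \int[mu]_(t in `[0%R, v]) kdens l b psi T (s, t))%E.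
  move=> u01 v01; have [r rcvg ->] := series_cvg _ _ u01 v01.
  by congr (_ + _)%:E; apply: cvg_lim rcvg.
split.
  move=> u v u01 v01; have [r rcvg _] := series_cvg _ _ u01 v01.
  by apply/cvg_ex; exists r.
split.
- exact: kdens_copula mpsi bpsi b_le b_le0 T_ge0 sum_b psi_mean _ CE.
- move=> u v _ _; rewrite /Cfun mulrC.
  rewrite (_ : Cterm phi lambda u v = Cterm phi lambda v u)//.
  by apply/funext => k; rewrite /Cterm mulrAC.
(* [fine] gives 0 where the series diverges, a null set in every section. *)
- exists (fine \o kdens l b psi T); split; last first.
    exact: kdens_square_integrable.
  split.
  + apply: measurable_funTS; exact: measurable_fine_kdens.
  + by move=> s t _ _ /=; rewrite fine_ge0//; exact: kdens_ge0.
  + move=> u v u01 v01; rewrite CE//; apply: eq_integral => s _.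
    by rewrite integral_fine_kdens//; exact: subI.
Qed.
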